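(* Let $F$ be a scalar group, let $V$ be a near-vector space over $F$, and let $W\subseteq V$. Then $W$ is an $F$-subspace of $V$ if and only if $W$ is the kernel of a linear map $\phi:V\to V'$ for some near-vector space $V'$ over $F$.
   Context: A scalar group is a tuple $F=(F,\cdot,1,0,-1)$ where $(F,\cdot,1)$ is a monoid, $0,-1\in F$, $0\cdot\alpha=0=\alpha\cdot 0$ for all $\alpha\in F$, $\{1,-1\}$ is the solution set of the equation $x^2=1$ in $F$, and $(F\setminus\{0\},\cdot,1)$ is a group. An $F$-space is an abelian group $(V,+)$ with a map $F\times V\to V$, $(\alpha,v)\mapsto\alpha\cdot v$, such that for all $\alpha,\beta\in F$, $v,w\in V$: $\alpha\cdot(\beta\cdot v)=(\alpha\cdot\beta)\cdot v$, $1\cdot v=v$, $\alpha\cdot(v+w)=\alpha\cdot v+\alpha\cdot w$, $(-1)\cdot v=-v$, $0\cdot v=0$. The quasi-kernel of an $F$-space $V$ is $Q(V)=\{v\in V\mid \forall \alpha,\beta\in F\ \exists\gamma\in F:\ \alpha\cdot v+\beta\cdot v=\gamma\cdot v\}$. A near-vector space over $F$ is an $F$-space $V$ whose action is free (if $\alpha\cdot v=\beta\cdot v$ then $v=0$ or $\alpha=\beta$) and such that $Q(V)$ generates $V$ as an additive group. An $F$-subspace of $V$ is a nonempty subset of $V$ closed under addition and scalar multiplication. A linear map between near-vector spaces over $F$ is a map $f$ with $f(x+y)=f(x)+f(y)$ and $f(\alpha\cdot x)=\alpha\cdot f(x)$; its kernel is $\{v\mid f(v)=0\}$. *)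

(* Defs.v *)
From HB Require Import structures.
From mathcomp Require Import all_boot all_order all_algebra.
From mathcomp Require Import boolp classical_sets.

Set Implicit Arguments.
Unset Strict Implicit.
Unset Printing Implicit Defensive.

Import GRing.Theory.
Local Open Scope classical_set_scope.
Local Open Scope ring_scope.

(* The scalars carry no addition, so -1 is a constant [sneg1] and not an
   opposite; [sneg1 = 1] is allowed. The last four axioms say that F \ {0} is
   a group for the multiplication of the monoid F. *)
HB.mixin Record Monoid_isScalarGroup F of Monoid F := {
  szero : F;
  sneg1 : F;
  mul_szero_l : forall a : F, (szero * a)%g = szero;
  mul_szero_r : forall a : F, (a * szero)%g = szero;
  sqr_eq1 : forall a : F, (a * a)%g = 1%g <-> a = 1%g \/ a = sneg1;
  sone_neq0 : 1%g <> szero;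
  smul_neq0 : forall a b : F, a <> szero -> b <> szero -> (a * b)%g <> szero;
  sinv_ex : forall a : F, a <> szero ->
    exists b : F, [/\ b <> szero, (b * a)%g = 1%g & (a * b)%g = 1%g]
}.

#[short(type="scalarGroupType")]
HB.structure Definition ScalarGroup :=
  {F of Monoid_isScalarGroup F & Monoid F}.

HB.mixin Record Zmodule_isFSpace (F : scalarGroupType) V of GRing.Zmodule V := {
  act : F -> V -> V;
  actA : forall (a b : F) (v : V), act a (act b v) = act (a * b)%g v;
  act1 : forall v : V, act 1%g v = v;
  actD : forall (a : F) (v w : V), act a (v + w) = act a v + act a w;
  actN1 : forall v : V, act sneg1 v = - v;
  act0 : forall v : V, act szero v = 0
}.

#[short(type="fSpaceType")]
HB.structure Definition FSpace (F : scalarGroupType) :=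
  {V of Zmodule_isFSpace F V & GRing.Zmodule V}.

Notation "a ⋅ v" := (act a v) (at level 40, left associativity) : ring_scope.

Definition quasi_kernel (F : scalarGroupType) (V : fSpaceType F) : set V :=
  [set v | forall a b : F, exists c : F, a ⋅ v + b ⋅ v = c ⋅ v].

Definition additive_subgroup (V : zmodType) (S : set V) : Prop :=
  zmod_closed (mem S).

HB.mixin Record FSpace_isNearVectorSpace (F : scalarGroupType) V
    of FSpace F V := {
  act_free : forall (a b : F) (v : V), a ⋅ v = b ⋅ v -> v = 0 \/ a = b;
  quasi_kernel_generates :
    smallest (@additive_subgroup V) (@quasi_kernel F V) = [set: V]
}.

#[short(type="nearVectorSpaceType")]
HB.structure Definition NearVectorSpace (F : scalarGroupType) :=
  {V of FSpace_isNearVectorSpace F V & FSpace F V}.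

Definition F_subspace (F : scalarGroupType) (V : fSpaceType F) (W : set V) :
    Prop :=
  [/\ W !=set0,
      forall v w : V, W v -> W w -> W (v + w)
    & forall (a : F) (v : V), W v -> W (a ⋅ v)].

Definition linear_map (F : scalarGroupType) (V V' : nearVectorSpaceType F)
    (f : V -> V') : Prop :=
  (forall x y : V, f (x + y) = f x + f y) /\
  (forall (a : F) (x : V), f (a ⋅ x) = a ⋅ f x).

Definition kernel (V V' : zmodType) (f : V -> V') : set V :=
  [set v | f v = 0].

(* Main.v *)
(** Only the freeness of the quotient V/W needs an argument: it is an F-space
generated by the images of Q(V), which lie in its quasi-kernel. Suppose
αv - βv ∈ W with α ≠ β, and write v = Σ a_i q_i modulo W with q_i ∈ Q(V).
Since q_1 ∈ Q(V), α a_1 q_1 - β a_1 q_1 = γ q_1. If γ = 0, freeness of V gives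
a_1 q_1 = 0; otherwise q_1 is, modulo W, in the span of the other q_i. In both
cases v is a combination of fewer q_i modulo W, and by induction v ∈ W. *)
Require Import Defs.
From HB Require Import structures.
From mathcomp Require Import all_boot all_order all_algebra.
From mathcomp Require Import boolp classical_sets.

Set Implicit Arguments.
Unset Strict Implicit.
Unset Printing Implicit Defensive.

Import GRing.Theory.
Local Open Scope quotient_scope.
Local Open Scope classical_set_scope.
Local Open Scope ring_scope.

(** * Spans of quasi-kernel elements over a subspace *)

Section FSpaceTheory.
Context (F : scalarGroupType) (V : fSpaceType F).
Implicit Types (a b : F) (v w q : V) (U W : set V) (s t : seq V).

Lemma actr0 a : a ⋅ (0 : V) = 0.
Proof. by apply: (addIr (a ⋅ 0)); rewrite -actD !add0r. Qed.

Lemma actrN a v : a ⋅ (- v) = - (a ⋅ v).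
Proof. by apply/eqP; rewrite -addr_eq0 -actD addNr actr0. Qed.

Lemma F_subspace0 W : F_subspace W -> W 0.
Proof. by move=> [[v Wv] _ WZ]; rewrite -(act0 v); apply: WZ. Qed.

Lemma F_subspaceN W v : F_subspace W -> W v -> W (- v).
Proof. by move=> [_ _ WZ] Wv; rewrite -actN1; apply: WZ. Qed.

Lemma F_subspaceB W v w : F_subspace W -> W v -> W w -> W (v - w).
Proof.
move=> Wsub Wv Ww; case: (Wsub) => _ WD _.
by apply: WD => //; apply: F_subspaceN.
Qed.

Lemma quasi_kernelB q a b :
  quasi_kernel q -> exists c, a ⋅ q - b ⋅ q = c ⋅ q.
Proof.
(* The difference is a sum, as [sneg1 * b] acts on [q] as the opposite of [b]. *)
by move=> Qq; have [c] := Qq a (sneg1 * b)%g; rewrite -actA actN1; exists c.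
Qed.

(** This is U + Fq. A single multiple of [q] is allowed, so closure under addition depends on
    [q]. *)
Definition adjoin q U : set V := [set v | exists a, U (v - a ⋅ q)].

Lemma sub_adjoin q U : U `<=` adjoin q U.
Proof. by move=> v Uv; exists szero; rewrite act0 subr0. Qed.

Lemma adjoin_subset q U W : U `<=` W -> adjoin q U `<=` adjoin q W.
Proof. by move=> UW v [a /UW Wv]; exists a. Qed.

Lemma adjoin_F_subspace q U :
  quasi_kernel q -> F_subspace U -> F_subspace (adjoin q U).
Proof.
move=> Qq Usub; case: (Usub) => _ UD UZ; split.
- by exists 0; apply: sub_adjoin; apply: F_subspace0.
(* Scalars cannot be added; membership of [q] in the quasi-kernel merges the two multiples of [q]
   into one. *)
- move=> v w [a Uv] [b Uw]; have [c qc] := Qq a b; exists c.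
  by rewrite -qc opprD addrACA; apply: UD.
- move=> a v [b Uv]; exists (a * b)%g.
  by rewrite -actA -actrN -actD; apply: UZ.
Qed.

(** W + Fq_1 + ... + Fq_n for [s] = [q_1, ..., q_n]. *)
Definition spanmod W s : set V := foldr adjoin W s.

Lemma sub_spanmod W s : W `<=` spanmod W s.
Proof.
by elim: s => [|q s IHs] //=; apply: subset_trans IHs (@sub_adjoin q _).
Qed.

Lemma spanmod_F_subspace W s : {in s, forall q, quasi_kernel q} ->
  F_subspace W -> F_subspace (spanmod W s).
Proof.
move=> + Wsub; elim: s => [|q s IHs] //= Qqs.
apply: adjoin_F_subspace; first by apply: Qqs; rewrite mem_head.
by apply: IHs => p ps; apply: Qqs; rewrite in_cons ps orbT.
Qed.

(** The span over [s ++ t] is the span of [s] over the base [spanmod W t], and spans grow with their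
    base. *)
Lemma sub_spanmod_cat W s t :
  spanmod W s `|` spanmod W t `<=` spanmod W (s ++ t).
Proof.
rewrite /spanmod foldr_cat -/(spanmod W t) -/(spanmod _ s).
move=> v [|/(@sub_spanmod _ s)] //.
by elim: s v => [|q s IHs] /=; [apply: sub_spanmod|apply: adjoin_subset].
Qed.

End FSpaceTheory.

(** * Freeness modulo a subspace *)

Section NearVectorSpaceTheory.
Context (F : scalarGroupType) (V : nearVectorSpaceType F).
Implicit Types (v : V) (W : set V).

(** [P] is a subgroup containing Q(V), which generates V. *)
Lemma nearVectorSpace_ind (P : set V) :
  P 0 -> (forall v w, P v -> P w -> P (v - w)) ->
  (forall q, quasi_kernel q -> P q) -> forall v, P v.
Proof.
move=> P0 PB PQ v.
have : [set: V] v by [].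
rewrite -quasi_kernel_generates; apply; split => //.
by split=> [|x y]; rewrite !inE //; apply: PB.
Qed.

Lemma spanmod_exists W v : F_subspace W ->
  exists2 s, {in s, forall q, quasi_kernel q} & spanmod W s v.
Proof.
move=> Wsub; pattern v; apply: nearVectorSpace_ind => [|x y|q Qq].
- by exists [::] => //; apply: F_subspace0.
- move=> [s Qs sx] [t Qt ty].
  have Qst : {in s ++ t, forall q, quasi_kernel q}.
    by move=> q; rewrite mem_cat => /orP[/Qs|/Qt].
  exists (s ++ t) => //; apply: F_subspaceB.
  + exact: spanmod_F_subspace.
  + by apply: sub_spanmod_cat; left.
  + by apply: sub_spanmod_cat; right.
- exists [:: q]; first by move=> p; rewrite inE => /eqP->.
  by exists 1%g; rewrite act1 subrr; apply: F_subspace0.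
Qed.

Lemma act_free_mod W (a b : F) v :
  F_subspace W -> W (a ⋅ v - b ⋅ v) -> W v \/ a = b.
Proof.
move=> Wsub Wabv; have [ab|ab] := pselect (a = b); [by right|left].
have [s Qs] := spanmod_exists v Wsub.
(* With [v] fixed, it suffices to drop the head [q], that is, to put [v] in [spanmod W s]. *)
elim: s Qs => [|q s IHs] //= Qqs [c sv].
have Qq : quasi_kernel q by apply: Qqs; rewrite mem_head.
have Qs : {in s, forall p, quasi_kernel p}.
  by move=> p ps; apply: Qqs; rewrite in_cons ps orbT.
have Ssub := spanmod_F_subspace Qs Wsub; case: (Ssub) => _ SD SZ.
apply: IHs => //.
have [d qd] := quasi_kernelB (a * c)%g (b * c)%g Qq.
have [d0|/sinv_ex[d' [_ d'd _]]] := pselect (d = szero).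
  (* Freeness of V is applied to the vector [c ⋅ q]: since [a] and [b] differ, it vanishes. *)
  move: qd; rewrite d0 act0 -!actA => /subr0_eq/act_free[cq0|//].
  by rewrite cq0 subr0 in sv.
have Sdq : spanmod W s (d ⋅ q).
  (* The first difference lies in W, and [v - c ⋅ q] lies in the span of [s]. *)
  have -> : d ⋅ q = (a ⋅ v - b ⋅ v) -
      (a ⋅ (v - c ⋅ q) - b ⋅ (v - c ⋅ q)).
    rewrite -qd !actD !actrN !actA [- (b ⋅ v + _)]opprD addrACA -opprD.
    by rewrite subKr.
  apply: F_subspaceB => //; first exact: sub_spanmod.
  by apply: (F_subspaceB Ssub); apply: SZ.
rewrite -[v](subrK (c ⋅ q)); apply: SD => //; apply: (SZ).
by rewrite -[q]act1 -d'd -actA; apply: SZ.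
Qed.

End NearVectorSpaceTheory.

(** * The quotient near-vector space V/W *)

Section QuotientSpace.
Context (F : scalarGroupType) (V : nearVectorSpaceType F) (W : set V).

(* The unused proof argument is what lets canonical inference find the
   closure properties of W. *)
Definition subspace_pred (Wsub : F_subspace W) : {pred V} :=
  fun v => v \in W.

Lemma subspace_pred_zmod_closed Wsub : zmod_closed (subspace_pred Wsub).
Proof.
split=> [|x y]; rewrite !unfold_in !inE; first exact: F_subspace0.
exact: F_subspaceB.
Qed.

HB.instance Definition _ Wsub :=
  GRing.isZmodClosed.Build V (subspace_pred Wsub)
    (subspace_pred_zmod_closed Wsub).

Context (Wsub : F_subspace W).

Definition quotient_space : Type := Quotient.quot (subspace_pred Wsub).
HB.instance Definition _ := GRing.Zmodule.on quotient_space.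

Definition quotient_map (v : V) : quotient_space :=
  \pi_(Quotient.quot (subspace_pred Wsub)) v.

Definition quotient_repr (x : quotient_space) : V :=
  @repr _ (Quotient.quot (subspace_pred Wsub)) x.

Lemma quotient_reprK : cancel quotient_repr quotient_map.
Proof. exact: (@reprK _ (Quotient.quot (subspace_pred Wsub))). Qed.

Lemma quotient_map_eq v w : quotient_map v = quotient_map w <-> W (v - w).
Proof.
rewrite -[W (v - w)]in_setE -[v - w \in W]/(v - w \in subspace_pred Wsub).
by rewrite Quotient.idealrBE; split=> /eqP.
Qed.

Lemma quotient_mapB v w :
  quotient_map (v - w) = quotient_map v - quotient_map w.
Proof. exact: (raddfB (\pi_(Quotient.quot (subspace_pred Wsub)))). Qed.

Lemma quotient_map0 : quotient_map 0 = 0.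
Proof. by rewrite -(subrr 0) quotient_mapB subrr. Qed.

Lemma quotient_mapN v : quotient_map (- v) = - quotient_map v.
Proof. by rewrite -[- v]add0r quotient_mapB quotient_map0 add0r. Qed.

Lemma quotient_mapD v w :
  quotient_map (v + w) = quotient_map v + quotient_map w.
Proof. by rewrite -[w]opprK quotient_mapB !quotient_mapN. Qed.

Lemma quotient_map_surj (x : quotient_space) : exists v, x = quotient_map v.
Proof. by exists (quotient_repr x); rewrite quotient_reprK. Qed.

Definition quotient_act (a : F) (x : quotient_space) : quotient_space :=
  quotient_map (a ⋅ quotient_repr x).

(** The action does not depend on the representative: two of them differ by an element of W, which
    scalars preserve. *)
Lemma quotient_actE a v :
  quotient_act a (quotient_map v) = quotient_map (a ⋅ v).
Proof.
apply/quotient_map_eq; rewrite -actrN -actD.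
have [_ _ WZ] := Wsub; apply/WZ/quotient_map_eq.
by rewrite quotient_reprK.
Qed.

Lemma quotient_actA a b x :
  quotient_act a (quotient_act b x) = quotient_act (a * b)%g x.
Proof. by have [v ->] := quotient_map_surj x; rewrite !quotient_actE actA. Qed.

Lemma quotient_act1 x : quotient_act 1%g x = x.
Proof. by have [v ->] := quotient_map_surj x; rewrite quotient_actE act1. Qed.

Lemma quotient_actD a x y :
  quotient_act a (x + y) = quotient_act a x + quotient_act a y.
Proof.
have [v ->] := quotient_map_surj x; have [w ->] := quotient_map_surj y.
by rewrite -quotient_mapD !quotient_actE actD quotient_mapD.
Qed.

Lemma quotient_actN1 x : quotient_act sneg1 x = - x.
Proof.
have [v ->] := quotient_map_surj x.
by rewrite quotient_actE actN1 quotient_mapN.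
Qed.

Lemma quotient_act0 x : quotient_act szero x = 0.
Proof.
have [v ->] := quotient_map_surj x.
by rewrite quotient_actE act0 quotient_map0.
Qed.

HB.instance Definition _ := Zmodule_isFSpace.Build F quotient_space
  quotient_actA quotient_act1 quotient_actD quotient_actN1 quotient_act0.

Lemma quotient_mapZ a v : quotient_map (a ⋅ v) = a ⋅ quotient_map v.
Proof. by rewrite -quotient_actE. Qed.

Lemma quotient_act_free (a b : F) (x : quotient_space) :
  a ⋅ x = b ⋅ x -> x = 0 \/ a = b.
Proof.
have [v ->] := quotient_map_surj x; rewrite -!quotient_mapZ.
move=> /quotient_map_eq/(act_free_mod Wsub)[Wv|]; [left|by right].
by rewrite -quotient_map0; apply/quotient_map_eq; rewrite subr0.
Qed.

Lemma quotient_quasi_kernel q :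
  quasi_kernel q -> quasi_kernel (quotient_map q).
Proof.
move=> Qq a b; have [c qc] := Qq a b; exists c.
by rewrite -!quotient_mapZ -quotient_mapD qc.
Qed.

(** The preimage in V of a subgroup containing Q(V/W) is a subgroup containing Q(V), hence all of V;
    surjectivity of the projection concludes. *)
Lemma quotient_quasi_kernel_generates :
  smallest (@additive_subgroup quotient_space)
    (@quasi_kernel F quotient_space) = [set: quotient_space].
Proof.
rewrite -subTset => x _ S [[S0 SB] QS].
have [v ->] := quotient_map_surj x; move: v.
apply: nearVectorSpace_ind => [|v w Sv Sw|q /quotient_quasi_kernel/QS //].
  by move: S0; rewrite inE quotient_map0.
rewrite quotient_mapB -in_setE.
by apply: (SB (quotient_map v) (quotient_map w)); rewrite inE.
Qed.

HB.instance Definition _ := FSpace_isNearVectorSpace.Build F quotient_space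
  quotient_act_free quotient_quasi_kernel_generates.

Lemma quotient_map_linear : linear_map quotient_map.
Proof. by split; [apply: quotient_mapD|apply: quotient_mapZ]. Qed.

Lemma kernel_quotient_map : kernel quotient_map = W.
Proof.
apply/seteqP; split=> v; rewrite /kernel /= -quotient_map0.
  by move/quotient_map_eq; rewrite subr0.
by move=> Wv; apply/quotient_map_eq; rewrite subr0.
Qed.

End QuotientSpace.

(** * Subspaces as kernels *)

Lemma kernel_F_subspace (F : scalarGroupType) (V V' : nearVectorSpaceType F)
    (phi : V -> V') :
  linear_map phi -> F_subspace (kernel phi).
Proof.
move=> [phiD phiZ]; split=> [|v w|a v]; rewrite /kernel /=.
- by exists 0 => /=; rewrite -(act0 0) phiZ act0.
- by rewrite phiD => -> ->; rewrite addr0.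
- by rewrite phiZ => ->; rewrite actr0.
Qed.

Theorem corollary4p4 (F : scalarGroupType) (V : nearVectorSpaceType F)
    (W : set V) :
  F_subspace W <->
  exists (V' : nearVectorSpaceType F) (phi : V -> V'),
    linear_map phi /\ W = kernel phi.
Proof.
split=> [Wsub|[V' [phi [phi_lin ->]]]]; last exact: kernel_F_subspace.
exists (quotient_space Wsub), (@quotient_map F V W Wsub); split.
- exact: quotient_map_linear.
- by rewrite kernel_quotient_map.
Qed.
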